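(* Let $\kappa$ be a regular uncountable cardinal with $\kappa^{<\kappa}=\kappa$, let $X\subseteq{}^\kappa\kappa$, let $A,B$ be disjoint subsets of $X$, let $1<\alpha<\kappa^+$, and let $G$ be $\mathbb{BM}_\alpha(A,B,X)$-generic over $V$. Then for each $\eta\in\mathrm{nonleaf}(T_\alpha)$ and $x\in X$ we have $x\in G_\eta\iff\langle\eta,x\rangle\in R_G$.
   Context: ${}^\kappa\kappa$ has the bounded topology with basic sets $[s]=\{x: s\subseteq x\}$, $s\in{}^{<\kappa}\kappa$. For a tree $T\subseteq{}^{<\omega}\kappa$: $\mathrm{succ}(\eta)$ is the set of immediate successors of $\eta$ in $T$, $\mathrm{succ}^2(\eta)=\bigcup_{\eta'\in\mathrm{succ}(\eta)}\mathrm{succ}(\eta')$, $\mathrm{pred}(\eta)$ the immediate predecessor of $\eta\neq\emptyset$; leaves are nodes without successors, $\mathrm{leaf}(T)$ is the set of leaves, $\mathrm{nonleaf}(T)=T\setminus\mathrm{leaf}(T)$; for well-founded $T$, $\mathrm{rk}(\eta)=0$ for leaves and $\mathrm{rk}(\eta)=\sup\{\mathrm{rk}(\nu)+1:\nu\in\mathrm{succ}(\eta)\}$ otherwise. Trees $T_\alpha$ ($\alpha<\kappa^+$): $T_0=\{\emptyset\}$; $T_{\alpha+1}=\{\emptyset\}\cup\{\langle i\rangle^\frown\eta: i<\kappa,\eta\in T_\alpha\}$; for limit $\delta$, with a fixed cofinal map $c_\delta:\mathrm{cf}(\delta)\to\delta$, $T_\delta=\{\emptyset\}\cup\{\langle i\rangle^\frown\eta: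 i<\mathrm{cf}(\delta),\eta\in T_{c_\delta(i)+4}\}$. A small limit is a limit ordinal of cofinality $<\kappa$; a node of $T_\alpha$ is a small limit node if its rank is a small limit. $\mathbb{BM}_\alpha(A,B,X)$ consists of pairs $p=\langle f_p,R_p\rangle$ with: (a) $f_p$ a partial function $\mathrm{leaf}(T_\alpha)\to{}^{<\kappa}\kappa$, $|f_p|<\kappa$; (b) $R_p\subseteq\mathrm{nonleaf}(T_\alpha)\times X$, $|R_p|<\kappa$; (c) if $\nu\in\mathrm{succ}(\eta)$ and $\langle\eta,x\rangle\in R_p$, then $\nu\in\mathrm{nonleaf}(T_\alpha)$ implies $\langle\nu,x\rangle\notin R_p$, and $\nu\in\mathrm{leaf}(T_\alpha)\cap\mathrm{dom}(f_p)$ implies $x\notin[f_p(\nu)]$; (d) $\{x:\langle\emptyset,x\rangle\in R_p\}\cap B=\emptyset$; (e) $\{x:\exists\eta\in\mathrm{succ}(\emptyset)\,\langle\eta,x\rangle\in R_p\}\cap A=\emptyset$; (f) if $\eta$ is $x$-critical in $p$, there is $\nu\in\mathrm{succ}(\eta)$ with $\langle\nu',x\rangle\notin R_p$ for all $\nu'\in\mathrm{succ}(\nu)$. Here $\eta$ is $x$-critical in $p$ if $\eta$ is a small limit node, and ($\langle\mathrm{pred}(\eta),x\rangle\in R_p$ or ($\mathrm{pred}(\eta)=\emptyset$ and $x\in A$) or ($\eta=\emptyset$ and $x\in B$)), and some $\eta'\in\mathrm{succ}^2(\eta)$ has $\langle\eta',x\rangle\in R_p$. Order: $q\le p$ iff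 $f_p\subseteq f_q$ and $R_p\subseteq R_q$. For a generic $G$: $f_G=\bigcup_{p\in G}f_p$ (a total function $\mathrm{leaf}(T_\alpha)\to{}^{<\kappa}\kappa$), $R_G=\bigcup_{p\in G}R_p$, and recursively $G_\eta=[f_G(\eta)]\cap X$ for leaves $\eta$, $G_\eta=\bigcap_{\nu\in\mathrm{succ}(\eta)}(X\setminus G_\nu)$ otherwise. *)

(* Defs.v *)
From HB Require Import structures.
From mathcomp Require Import all_boot all_order.
From mathcomp Require Import boolp classical_sets functions cardinality.

Set Implicit Arguments.
Unset Strict Implicit.
Unset Printing Implicit Defensive.

Import Order.TTheory.
Local Open Scope order_scope.
Local Open Scope classical_set_scope.
Local Open Scope card_scope.

(* ---------------------------------------------------------------------- *)
(* Ordinals.  An [ordType] is an initial segment of the class of ordinals *)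
(* closed under successor; an element is identified with the set of its   *)
(* predecessors, as for von Neumann ordinals.                             *)

HB.mixin Record isOrdinals d O of Order.BTotal d O := {
  ord_lt_wf : well_founded (fun x y : O => (x < y)%O);
  ord_no_max : forall x : O, exists y : O, (x < y)%O
}.

#[short(type="ordType")]
HB.structure Definition Ordinals d := {O of Order.BTotal d O & isOrdinals d O}.

Section Ordinals.
Context {d : Order.disp_t} {O : ordType d}.
Implicit Types (a b g i k : O) (S : set O).

Definition seg a : set O := [set i | i < a].

Definition ord a : Type := {i : O | i < a}.

(* [\bot] if [S] is empty *)
Definition oleast S : O := xget \bot [set m | S m /\ forall a, S a -> m <= a].

Definition osucc a : O := oleast [set b | a < b].

Definition is_limit a : Prop := a <> \bot /\ forall b, b < a -> osucc b < a.

Definition cofinal_map g a (h : O -> O) : Prop :=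
  (forall i, i < g -> h i < a) /\
  (forall b, b < a -> exists2 i, i < g & b <= h i).

Definition cf a : O := oleast [set g | exists h, cofinal_map g a h].

Definition is_cardinal k : Prop := forall a, a < k -> ~ (seg k #<= seg a).

Definition regular_cardinal k : Prop :=
  [/\ is_cardinal k, infinite_set (seg k) & cf k = k].

Definition is_succ_cardinal k k' : Prop :=
  [/\ is_cardinal k', k < k' & forall l, is_cardinal l -> k < l -> k' <= l].

Definition card_lt {T : Type} (A : set T) k : Prop :=
  A #<= seg k /\ ~ (seg k #<= A).

Definition small_limit k a : Prop := is_limit a /\ cf a < k.

(* The generalized Baire space and its bounded sequences. *)

Definition baire k : Type := ord k -> ord k.

Record shortseq k := ShortSeq {
  blen : ord k;
  bval : ord (sval blen) -> ord k }.

Definition prefix_of k (s : shortseq k) (x : baire k) : Prop :=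
  forall (i : ord (sval (blen s))) (j : ord k), sval i = sval j ->
    bval i = x j.

Definition basic_open k (s : shortseq k) : set (baire k) := [set x | prefix_of s x].

End Ordinals.

Record ladder {d} (O : ordType d) := Ladder {
  lfun :> O -> O -> O;
  lfunP : forall a : O, is_limit a -> cofinal_map (cf a) a (lfun a) }.

(* ---------------------------------------------------------------------- *)

Section Trees.
Context {d : Order.disp_t} {O : ordType d}.

Definition node : Type := seq O.

Section Generic.
Variable T : set node.
Implicit Types eta nu : node.

Definition succs eta : set node := [set nu | T nu /\ exists i, nu = rcons eta i].

Definition succs2 eta : set node := \bigcup_(nu in succs eta) succs nu.

(* only meaningful for [eta <> [::]] *)
Definition npred eta : node := take (size eta).-1 eta.

Definition leaf : set node := [set eta | T eta /\ succs eta = set0].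

Definition nonleaf : set node := T `\` leaf.

Inductive has_rank : node -> O -> Prop :=
| rank_leaf eta : leaf eta -> has_rank eta \bot
| rank_nonleaf eta (r : node -> O) (rho : O) :
    nonleaf eta ->
    (forall nu, succs eta nu -> has_rank nu (r nu)) ->
    supremums [set osucc (r nu) | nu in succs eta] rho ->
    has_rank eta rho.

Definition small_limit_node (k : O) : set node :=
  [set eta | T eta /\ exists2 rho, has_rank eta rho & small_limit k rho].

End Generic.

Variables (kappa : O) (c : ladder O).

Inductive tree : O -> set node :=
| tree_root a : tree a [::]
| tree_succ a i eta : i < kappa -> tree a eta -> tree (osucc a) (i :: eta)
| tree_limit a i eta : is_limit a -> i < cf a ->
    tree (iter 4 osucc (c a i)) eta -> tree a (i :: eta).

End Trees.

Arguments node {d} O.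

Lemma oleastP (d : Order.disp_t) (O : ordType d) (S : set O) (a : O) :
  S a -> S (oleast S) /\ forall b, S b -> oleast S <= b.
Proof.
move=> Sa; apply: (xgetPex \bot (P := [set m | S m /\ forall b, S b -> m <= b])).
elim/(well_founded_ind (@ord_lt_wf d O)): a Sa => a IH Sa.
have [[b Sb ba]|na] := pselect (exists2 b, S b & b < a); first exact: (IH b).
exists a; split=> // b Sb; rewrite leNgt; apply/negP => ba.
by apply: na; exists b.
Qed.

Lemma osuccP (d : Order.disp_t) (O : ordType d) (a : O) :
  a < osucc a /\ forall b, a < b -> osucc a <= b.
Proof. by have [b ab] := ord_no_max a; apply: (@oleastP _ _ [set b | a < b] b). Qed.

Lemma tree_cons (d : Order.disp_t) (O : ordType d) (kappa : O) (c : ladder O)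
    (a i : O) (eta : node O) : tree kappa c a (i :: eta) ->
  exists2 b, b < a &
    forall nu, tree kappa c a (i :: nu) -> tree kappa c b nu.
Proof.
have nlim b : ~ is_limit (osucc b).
  by move=> [_ /(_ b (osuccP b).1)]; rewrite ltxx.
have sinj : injective (@osucc d O).
  move=> x y xy; apply/eqP; rewrite eq_le !leNgt.
  apply/andP; split; apply/negP => /(osuccP _).2;
    [rewrite -xy | rewrite xy]; by rewrite leNgt (osuccP _).1.
suff [[nl [b ab]]|la] : (~ is_limit a /\ exists b, a = osucc b) \/
    (is_limit a /\ i < cf a) \/ ~ exists nu, tree kappa c a (i :: nu).
- move=> _; exists b; first by rewrite ab; exact: (osuccP b).1.
  move=> nu t; inversion t; subst => //.
  by have <- : a0 = b by apply: sinj; congruence.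
- move=> t; case: la => [[la ia]|[]]; last by exists eta.
  exists (iter 4 osucc (c a i)).
    by do 4!apply: la.2; exact: (lfunP c la).1.
  move=> nu t'; inversion t'; subst => //.
  by case: (nlim _ _ _ la).
have [[nu t]|nt] := pselect (exists nu, tree kappa c a (i :: nu));
  last by right; right.
inversion t; subst; first by left; split=> //; exists a0.
by right; left.
Qed.

Lemma tree_wf (d : Order.disp_t) (O : ordType d) (kappa : O) (c : ladder O)
    (a : O) :
  well_founded (fun nu eta : node O => succs (tree kappa c a) eta nu).
Proof.
suff acc eta : tree kappa c a eta ->
    Acc (fun nu eta => succs (tree kappa c a) eta nu) eta.
  by move=> eta; constructor=> nu [/acc].
elim/(well_founded_ind (@ord_lt_wf d O)): a eta => a IH.
have acc1 i eta : tree kappa c a (i :: eta) ->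
    Acc (fun nu eta => succs (tree kappa c a) eta nu) (i :: eta).
  move=> t; have [b ba sub] := tree_cons t.
  elim: (IH b ba eta (sub eta t)) => {t}{}eta _ IHa.
  constructor=> nu [t [j nuE]]; rewrite {}nuE /= in t *.
  by apply: IHa; split; [exact: sub | exists j].
case=> [_|i eta]; last exact: acc1.
by constructor=> nu [t [j nuE]]; rewrite {}nuE /= in t *; apply: acc1.
Qed.

(* ---------------------------------------------------------------------- *)
(* Forcing over the ambient universe as ground model.  [formula] is the   *)
(* infinitary propositional forcing language; its atoms say that a        *)
(* condition is in the generic filter, or that [Q] is true in the ground  *)
(* model.                                                                 *)

Section Forcing.
Variables (P : Type) (le : P -> P -> Prop).

Inductive formula : Type :=
| Gen of P
| Ground of Prop
| Neg of formula
| Conj (I : Type) of (I -> formula).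

Definition And (phi psi : formula) : formula :=
  Conj (fun b : bool => if b then phi else psi).

Definition Ex (I : Type) (F : I -> formula) : formula :=
  Neg (Conj (fun i => Neg (F i))).

Definition Imp (phi psi : formula) : formula := Neg (And phi (Neg psi)).

Definition Iff (phi psi : formula) : formula := And (Imp phi psi) (Imp psi phi).

Fixpoint forces (p : P) (phi : formula) : Prop :=
  match phi with
  | Gen q => forall r, le r p -> exists2 t, le t r & le t q
  | Ground Q => Q
  | Neg psi => forall q, le q p -> ~ forces q psi
  | Conj _ F => forall i, forces p (F i)
  end.

(* [phi] holds in V[G] for every G generic over V *)
Definition forced (phi : formula) : Prop := forall p, forces p phi.

(* The meaning of a formula at an actual filter, and the truth lemma.     *)

Fixpoint holds (G : set P) (phi : formula) : Prop :=
  match phi with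
  | Gen q => G q
  | Ground Q => Q
  | Neg psi => ~ holds G psi
  | Conj _ F => forall i, holds G (F i)
  end.

Definition is_filter (G : set P) : Prop :=
  [/\ exists p, G p,
      forall p q, G p -> le p q -> G q &
      forall p q, G p -> G q -> exists r, [/\ G r, le r p & le r q]].

Definition dense (D : set P) : Prop := forall p, exists2 q, le q p & D q.

(* [V] contains the dense sets which decide the subformulas of [phi] *)
Fixpoint decided_in (V : set (set P)) (phi : formula) : Prop :=
  match phi with
  | Gen q => V [set r | le r q \/ forall t, le t r -> ~ le t q]
  | Ground _ => True
  | Neg psi => decided_in V psi /\
      V [set q | forces q psi \/ forces q (Neg psi)]
  | Conj _ F => (forall i, decided_in V (F i)) /\
      V [set q | forces q (Conj F) \/ exists i, forces q (Neg (F i))]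
  end.

Hypothesis le_refl : forall p, le p p.
Hypothesis le_tr : forall p q r, le p q -> le q r -> le p r.

Lemma forces_mono p q phi : le q p -> forces p phi -> forces q phi.
Proof.
elim: phi p q => [r|Q|psi _|I F IH] p q qp //= fp.
- by move=> t tq; apply: fp; apply: le_tr tq qp.
- by move=> t tq; apply: fp; apply: le_tr tq qp.
- by move=> i; apply: IH qp (fp i).
Qed.

Lemma forces_dense_below p phi :
  (forall r, le r p -> exists2 t, le t r & forces t phi) -> forces p phi.
Proof.
elim: phi p => [q|Q|psi _|I F IH] p dp /=.
- move=> r /dp[t tr ft]; have [u ut uq] := ft t (le_refl t).
  by exists u => //; apply: le_tr ut tr.
- by have [] := dp p (le_refl p).
- move=> q /dp[t tq ft] fq; apply: (ft t) => //; exact: forces_mono tq fq.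
- move=> i; apply: IH => r /dp[t tr ft]; exists t => //; exact: ft.
Qed.

Lemma holds_iff_forces (V : set (set P)) (G : set P) phi :
  is_filter G -> (forall D, V D -> dense D -> exists2 p, G p & D p) ->
  decided_in V phi -> holds G phi <-> exists2 p, G p & forces p phi.
Proof.
move=> [[p0 Gp0] Gup Gdir] meet.
elim: phi => [q|Q|psi IH|I F IH] /=.
- move=> VD; split=> [Gq|[p Gp fp]].
    by exists q => // r rq; exists r.
  have [r Gr [/(Gup _ _ Gr)//|nr]] : exists2 r, G r &
      (le r q \/ forall t, le t r -> ~ le t q).
    apply: meet VD _ => s; have [[t ts tq]|ns] :=
      pselect (exists2 t, le t s & le t q); first by exists t => //; left.
    by exists s => //; right=> t ts tq; apply: ns; exists t.
  have [t [_ tp tr]] := Gdir _ _ Gp Gr.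
  by have [u ut uq] := fp t tp; case: (nr u) => //; apply: le_tr ut tr.
- by move=> _; split=> [q|[]//]; exists p0.
- move=> [/IH {}IH VD]; split=> [nh|[p Gp fp] /IH [q Gq fq]]; last first.
    by have [r [_ rp rq]] := Gdir _ _ Gp Gq; apply: (fp r rp);
       apply: forces_mono rq fq.
  have [r Gr [fr|nr]] : exists2 r, G r &
      (forces r psi \/ forall q, le q r -> ~ forces q psi).
    apply: meet VD _ => s; have [[t ts ft]|ns] :=
      pselect (exists2 t, le t s & forces t psi); first by exists t => //; left.
    by exists s => //; right=> t ts ft; apply: ns; exists t.
  + by case: nh; apply/IH; exists r.
  + by exists r.
- move=> [dF VD]; split=> [h|[p Gp fp] i]; last first.
    by apply/(IH i (dF i)); exists p.
  have [r Gr [fr|[i nr]]] : exists2 r, G r &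
      (forces r (Conj F) \/ exists i, forces r (Neg (F i))).
  + apply: meet VD _ => s.
    have [fs|/existsNP[i nfs]] := pselect (forall i, forces s (F i)).
      by exists s => //; left.
    have [[t ts ft]|ns] :=
      pselect (exists2 t, le t s & forces t (Neg (F i))).
      by exists t => //; right; exists i.
    case: nfs; apply: forces_dense_below => r rs.
    apply: contrapT => nr; apply: ns; exists r => // t tr ft.
    by apply: nr; exists t.
  + by exists r.
  + have /(IH i (dF i)) [p Gp fp] := h i.
    by have [t [_ tp tr]] := Gdir _ _ Gp Gr; case: (nr t tr);
       apply: forces_mono tp fp.
Qed.

End Forcing.

(* ---------------------------------------------------------------------- *)

Section BM.
Context {d : Order.disp_t} {O : ordType d}.
Variables (kappa : O) (c : ladder O) (alpha : O).
Variables (A B X : set (baire kappa)).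

Let T := tree kappa c alpha.

Record precond := Precond {
  fpart : set (node O * shortseq kappa);
  Rpart : set (node O * baire kappa) }.

Definition critical (p : precond) (x : baire kappa) (eta : node O) : Prop :=
  [/\ small_limit_node T kappa eta,
      [\/ eta <> [::] /\ Rpart p (npred eta, x),
          [/\ eta <> [::], npred eta = [::] & A x] |
          eta = [::] /\ B x] &
      exists2 eta', succs2 T eta eta' & Rpart p (eta', x)].

Record bm_cond (p : precond) : Prop := BMCond {
  bm_f_dom : forall eta s, fpart p (eta, s) -> leaf T eta;
  bm_f_fun : forall eta s s', fpart p (eta, s) -> fpart p (eta, s') -> s = s';
  bm_f_card : card_lt (fpart p) kappa;
  bm_R_dom : Rpart p `<=` nonleaf T `*` X;
  bm_R_card : card_lt (Rpart p) kappa;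
  bm_c : forall eta nu x, succs T eta nu -> Rpart p (eta, x) ->
    (nonleaf T nu -> ~ Rpart p (nu, x)) /\
    (leaf T nu -> forall s, fpart p (nu, s) -> ~ basic_open s x);
  bm_d : [set x | Rpart p ([::], x)] `&` B = set0;
  bm_e : [set x | exists2 eta, succs T [::] eta & Rpart p (eta, x)] `&` A = set0;
  bm_f : forall x eta, critical p x eta ->
    exists2 nu, succs T eta nu &
      forall nu', succs T nu nu' -> ~ Rpart p (nu', x) }.

Definition BM : Type := {p : precond | bm_cond p}.

Definition BM_le (q p : BM) : Prop :=
  fpart (sval p) `<=` fpart (sval q) /\ Rpart (sval p) `<=` Rpart (sval q).

(* f_G, R_G and G_eta as predicates valued in the forcing language over   *)
(* the generic filter G.                                                  *)

Definition in_fG (eta : node O) (s : shortseq kappa) : formula BM :=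
  Ex (fun p : BM => And (Gen p) (Ground BM (fpart (sval p) (eta, s)))).

Definition in_RG (eta : node O) (x : baire kappa) : formula BM :=
  Ex (fun p : BM => And (Gen p) (Ground BM (Rpart (sval p) (eta, x)))).

Definition in_Gset_step (eta : node O)
    (rec : forall nu, succs T eta nu -> baire kappa -> formula BM)
    (x : baire kappa) : formula BM :=
  if pselect (leaf T eta) then
    And (Ex (fun s => And (in_fG eta s) (Ground BM (basic_open s x))))
        (Ground BM (X x))
  else
    Conj (fun nu : {nu | succs T eta nu} =>
      And (Ground BM (X x)) (Neg (rec (sval nu) (svalP nu) x))).

Definition in_Gset : node O -> baire kappa -> formula BM :=
  Fix (@tree_wf d O kappa c alpha) (fun _ => baire kappa -> formula BM)
    in_Gset_step.

Lemma in_GsetE eta :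
  in_Gset eta = @in_Gset_step eta (fun nu _ => in_Gset nu).
Proof.
rewrite /in_Gset Fix_eq // => {}eta f g fg; apply/funext => x.
rewrite /in_Gset_step; case: pselect => //= _.
by congr Conj; apply/funext => nu; rewrite fg.
Qed.

End BM.

Arguments BM_le {d O kappa c alpha A B X} q p.

(* Main.v *)
(* By density, it suffices to show that every condition p has, for x in X and
   eta a non-leaf, an extension q with (eta, x) in R_q, or (nu, x) in R_q for a
   child nu of eta, or x in [f_q(nu)] for a leaf child nu; the theorem then
   follows by induction on eta, clause (c) giving the implication from R_G to
   G_eta.  Try to add (eta, x).  If (c), (d) or (e) prevents this, add a child
   of eta instead: one not mentioned in p if eta has at least kappa children,
   and otherwise the child provided by (f).  If instead (f) would fail at a
   grandparent of eta, then eta has successor rank, so that a fresh child can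
   be added; if (f) would fail at a child of eta, that child can itself be
   added. *)

Require Import Defs.
From mathcomp Require Import all_boot all_order.
From mathcomp Require Import boolp classical_sets functions cardinality.

Import Order.TTheory.
Local Open Scope order_scope.
Local Open Scope classical_set_scope.
Local Open Scope card_scope.

(** * Ordinals: successors, limits and cofinality *)

Section OrdinalFacts.
Context {d : Order.disp_t} {O : ordType d}.
Implicit Types (a b : O).

Lemma lt_osucc a : a < osucc a.
Proof. exact: (osuccP a).1. Qed.

Lemma osucc_le {a b} : a < b -> osucc a <= b.
Proof. exact: (osuccP a).2. Qed.

Lemma osucc_inj : injective (@osucc d O).
Proof.
move=> a b ab; apply/eqP; rewrite eq_le !leNgt; apply/andP; split;
  apply/negP => /osucc_le; rewrite ?ab -?ab leNgt ?lt_osucc //.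
by rewrite ab lt_osucc.
Qed.

Lemma osucc_neq_bot {a} : osucc a <> \bot.
Proof. by move=> e; have := lt_osucc a; rewrite e ltNge le0x. Qed.

Lemma not_limit_osucc {a} : ~ is_limit (osucc a).
Proof. by move=> [_ /(_ a (lt_osucc a))]; rewrite ltxx. Qed.

Lemma bot_succ_limit a : [\/ a = \bot, exists b, a = osucc b | is_limit a].
Proof.
have [->|/eqP a0] := eqVneq a \bot; first by constructor 1.
have [la|nl] := pselect (is_limit a); first by constructor 3.
constructor 2; apply: contrapT => ns; apply: nl; split=> // b ba.
rewrite lt_neqAle osucc_le // andbT; apply/eqP => e.
by apply: ns; exists b.
Qed.

Lemma neq_bot_gt0 {a} : a <> \bot -> \bot < a.
Proof. by move=> a0; rewrite lt0x; apply/eqP. Qed.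

Lemma limit_gt0 {a} : is_limit a -> \bot < a.
Proof. by move=> [/neq_bot_gt0]. Qed.

Lemma iter_osucc_lt_limit a b n : is_limit a -> b < a -> iter n osucc b < a.
Proof. by move=> la ba; elim: n => //= n IH; apply: la.2. Qed.

Lemma cf_le a g h : cofinal_map g a h -> cf a <= g.
Proof.
move=> ch; have S : [set g' | exists h', cofinal_map g' a h'] g by exists h.
by have [_] := oleastP S; apply.
Qed.

End OrdinalFacts.

(** * Sets of cardinality below a regular cardinal *)

Lemma inj_card_leP {T U : Type} (A : set T) (B : set U) (u0 : U) :
  (A #<= B) <-> exists2 f : T -> U,
    forall t, A t -> B (f t) & forall t t', A t -> A t' -> f t = f t' -> t = t'.
Proof.
split; last first.
  move=> [f fB fi]; have fAB : f @` A `<=` B by move=> _ [t /fB Bt <-].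
  apply: card_le_trans (subset_card_le fAB).
  suff /card_eqPle[] : f @` A #= A by [].
  by apply: inj_card_eq => t t' /set_mem At /set_mem At'; exact: fi.
(* The point [u0] rules out an empty [U], for which no total [f] need exist. *)
elim/Ppointed: U => U in B u0 *; first by case: (no u0).
move=> /pcard_leP[f]; exists f => [t At|t t' At At']; first exact: funS.
by apply: inj; exact: mem_set.
Qed.

Section RegularCardinal.
Context {d : Order.disp_t} {O : ordType d}.
Context {kappa : O}.
Hypothesis kreg : regular_cardinal kappa.

Lemma regular_limit : is_limit kappa.
Proof.
have [kc kinf kcf] := kreg.
have [k0|[b kb]|//] := bot_succ_limit kappa.
  by case: kinf; rewrite (_ : seg kappa = set0) //; apply/seteqP; split=> // i;
    rewrite /seg /= k0 ltx0.
case: kinf; suff : kappa <= osucc \bot.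
  move=> k1; apply: (sub_finite_set (B := [set \bot])); last exact: finite_set1.
  move=> i; rewrite /seg /= => ik; apply: contrapT => /neq_bot_gt0 /osucc_le i1.
  by have := lt_le_trans ik (le_trans k1 i1); rewrite ltxx.
(* If [kappa] is the successor of [b], the constant map to [b] is cofinal of length 1, so that
   [kappa] would be at most 1. *)
rewrite -[X in X <= _]kcf; apply: (@cf_le _ _ _ _ (fun=> b)); split.
  by move=> _ _; rewrite kb lt_osucc.
move=> a ak; exists \bot; first exact: lt_osucc.
by rewrite leNgt; apply/negP => /osucc_le; rewrite -kb leNgt ak.
Qed.

(* The enumeration of an unbounded subset of [kappa] does not stop before
   [kappa], since it would be a cofinal map of smaller length. *)
Lemma unbounded_card (I : set O) : I `<=` seg kappa ->
  (forall b, b < kappa -> exists2 i, I i & b <= i) -> seg kappa #<= I.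
Proof.
move=> Ik Iu; have [_ _ kcf] := kreg.
(* Each value is the least element of [I] above all earlier ones. For indices below [kappa] such an
   element exists, so the default [\bot] of [oleast] does not interfere. *)
pose F (i : O) (rec : forall j : O, j < i -> O) :=
  oleast [set m | I m /\ forall j (ji : j < i), rec j ji < m].
pose h := Fix (@ord_lt_wf d O) (fun=> O) F.
have hE i : h i = oleast [set m | I m /\ forall j, j < i -> h j < m].
  rewrite /h Fix_eq // => {}i f g fg.
  by congr oleast; apply/funext => m; congr (_ /\ _);
    apply: eq_forall => j; apply: eq_forall => ji; rewrite fg.
have hP i : i < kappa -> I (h i) /\ forall j, j < i -> h j < h i.
  elim/(well_founded_ind (@ord_lt_wf d O)): i => i IH ik.
  have hk j : j < i -> h j < kappa.
    by move=> ji; apply: Ik; have [] := IH j ji (lt_trans ji ik).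
  have [b bk hb] : exists2 b, b < kappa & forall j, j < i -> h j < b.
    apply: contrapT => nb; suff /cf_le : cofinal_map i kappa h.
      by rewrite kcf leNgt ik.
    split=> // b bk; apply: contrapT => nj; apply: nb; exists b => // j ji.
    by rewrite ltNge; apply/negP => bj; apply: nj; exists j.
  have [m Im bm] := Iu b bk.
  have S : [set m | I m /\ forall j, j < i -> h j < m] m.
    by split=> // j /hb /lt_le_trans; apply.
  by rewrite hE; have [[]] := oleastP S.
apply/(inj_card_leP _ _ kappa); exists h => [i /hP[]//|i j ik jk e].
have [/(hP j jk).2|/(hP i ik).2|//] := ltgtP i j; by rewrite e ltxx.
Qed.

(** Otherwise the values of [g] on [S] below [kappa] would be unbounded, hence [kappa] many. This is
    the source of fresh indices and of bounds on lengths of sequences. *)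
Lemma card_lt_bounded {T : Type} {S : set T} (g : T -> O) : card_lt S kappa ->
  exists2 b, b < kappa & forall s, S s -> g s < kappa -> g s < b.
Proof.
move=> [_ Sk]; apply: contrapT => nb; apply: Sk.
apply: card_le_trans (card_image_le g S).
have IS : g @` S `&` seg kappa `<=` g @` S by move=> ? [].
apply: card_le_trans (subset_card_le IS); apply: unbounded_card => [? []//|b bk].
apply: contrapT => ni; apply: nb; exists b => // s Ss sk.
by rewrite ltNge; apply/negP => bs; apply: ni; exists (g s) => //; split=> //; exists s.
Qed.

Lemma card_ltU1 {T : Type} (S : set T) (a : T) : card_lt S kappa ->
  card_lt (S `|` [set a]) kappa.
Proof.
move=> [Sk kS]; have kl := regular_limit; split.
  have /(inj_card_leP _ _ \bot)[f fk fi] := Sk.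
  apply/(inj_card_leP _ _ \bot).
  (* Shifting the given injection by one frees the value [\bot] for the new point. *)
  pose g t := if pselect (S t) then osucc (f t) else \bot.
  exists g => [t _|t t']; rewrite /g.
    by case: pselect => /= [/fk ftk|_]; [exact: kl.2 | exact: limit_gt0].
  move=> [St|->] [St'|->]; do 2?case: pselect => //= ?.
  - by move=> /osucc_inj; exact: fi.
  - by move=> /osucc_inj; exact: fi.
  - by move=> /osucc_neq_bot [].
  - by move=> /osucc_inj; exact: fi.
  - by move=> /esym/osucc_neq_bot [].
move=> /(inj_card_leP _ _ a)[f fS fi].
(* Conversely, given an injection into the enlarged set, the indices that it sends into [S] are
   bounded by some [b]; then [b] and its successor both go to [a]. *)
have nJ : ~ (seg kappa #<= [set i | i < kappa /\ S (f i)]).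
  move=> kJ; apply: kS; apply: card_le_trans kJ _.
  apply/(inj_card_leP _ _ a); exists f => [i []//|i j [ik _] [jk _]]; exact: fi.
apply: nJ; apply: unbounded_card => [i []//|b bk]; apply: contrapT => nb.
have fa i : i < kappa -> b <= i -> f i = a.
  by move=> ik bi; have [Sfi|//] := fS i ik; case: nb; exists i.
have := fi _ _ bk (kl.2 _ bk); rewrite (fa b) // (fa (osucc b)) ?(ltW (lt_osucc _)) //.
  by move=> /(_ erefl) e; have := lt_osucc b; rewrite -e ltxx.
exact: kl.2.
Qed.

End RegularCardinal.

(** * Ranks of nodes and the subtrees above them *)

Section Ranks.
Context {d : Order.disp_t} {O : ordType d}.

Lemma has_rank_uniq {T : set (node O)} {eta rho rho'} :
  has_rank T eta rho -> has_rank T eta rho' -> rho = rho'.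
Proof.
move=> h; elim: h rho' => {eta rho} [eta le|eta r rho nle _ IH srho] rho' h.
  by inversion h as [|? ? ? [_ nle]]; subst.
inversion h as [? le|? r' ? _ hr srho']; subst; first by case: nle.
have e : [set osucc (r nu) | nu in succs T eta] =
         [set osucc (r' nu) | nu in succs T eta].
  by apply: eq_imagel => nu nus; rewrite (IH nu nus _ (hr nu nus)).
rewrite -e in srho'; case: srho => u l; case: srho' => u' l'.
by apply/eqP; rewrite eq_le l // l'.
Qed.

Context {kappa : O} {c : ladder O}.
Hypothesis kappa_gt0 : \bot < kappa.

Lemma tree_bot_cons {i eta} : ~ tree kappa c \bot (i :: eta).
Proof.
move=> t; inversion t as [|? ? ? ? ? e|? ? ? [l _]] => //.
exact: (osucc_neq_bot e).
Qed.

Lemma tree_succ_cons {a i eta} :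
  tree kappa c (osucc a) (i :: eta) <-> i < kappa /\ tree kappa c a eta.
Proof.
split=> [t|[]]; last exact: tree_succ.
inversion t as [|? ? ? ik t' e|? ? ? l]; subst; last by case: (not_limit_osucc l).
by rewrite -(osucc_inj _ _ e).
Qed.

Lemma tree_limit_cons {a i eta} : is_limit a ->
  tree kappa c a (i :: eta) <->
  i < cf a /\ tree kappa c (iter 4 osucc (c a i)) eta.
Proof.
move=> la; split=> [t|[]]; last exact: tree_limit.
inversion t as [|? ? ? ik t' e|? ? ? l]; subst => //.
by case: (not_limit_osucc la).
Qed.

Lemma tree_rcons {a i eta} : tree kappa c a (rcons eta i) -> tree kappa c a eta.
Proof.
elim: eta a => [|j eta IH] a t; first exact: tree_root.
inversion t; subst; first by apply: tree_succ => //; exact: IH.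
by apply: tree_limit => //; exact: IH.
Qed.

Context {alpha : O}.
Let T := tree kappa c alpha.

(** The part of the tree above [eta] is a copy of the tree of index [beta]. This [beta] turns out to
    be the rank of [eta], so leaves and small limit nodes can be recognised from it. *)
Definition cone (eta : node O) (beta : O) : Prop :=
  forall nu, T (eta ++ nu) <-> tree kappa c beta nu.

Lemma cone_tree {eta beta} : cone eta beta -> T eta.
Proof. by move=> /(_ [::]); rewrite cats0 => ->; exact: tree_root. Qed.

Lemma cone_rcons_succ {eta a} : cone eta (osucc a) ->
  forall i, T (rcons eta i) <-> i < kappa.
Proof.
move=> ce i; rewrite -cats1 ce tree_succ_cons; split=> [[]//|ik].
by split=> //; exact: tree_root.
Qed.

Lemma cone_child_succ {eta a i} : cone eta (osucc a) -> i < kappa ->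
  cone (rcons eta i) a.
Proof.
move=> ce ik nu; rewrite cat_rcons ce tree_succ_cons; split=> [[]//|t].
by split.
Qed.

Lemma cone_rcons_limit {eta a} : is_limit a -> cone eta a ->
  forall i, T (rcons eta i) <-> i < cf a.
Proof.
move=> la ce i; rewrite -cats1 ce tree_limit_cons //; split=> [[]//|ik].
by split=> //; exact: tree_root.
Qed.

Lemma cone_child_limit {eta a i} : is_limit a -> cone eta a -> i < cf a ->
  cone (rcons eta i) (iter 4 osucc (c a i)).
Proof.
move=> la ce ik nu; rewrite cat_rcons ce tree_limit_cons //; split=> [[]//|t].
by split.
Qed.

Lemma cf_limit_gt0 {a : O} : is_limit a -> \bot < cf a.
Proof.
move=> la; have [_ /(_ _ (limit_gt0 la))[i ic _]] := lfunP c la.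
exact: le_lt_trans (le0x i) ic.
Qed.

Lemma cone_leaf {eta beta} : cone eta beta -> leaf T eta <-> beta = \bot.
Proof.
move=> ce; split=> [[_ e]|b0].
  have nochild i : ~ T (rcons eta i).
    move=> ti; have : succs T eta (rcons eta i) by split=> //; exists i.
    by rewrite e.
  (* Unless [beta] is [\bot], the child with index [\bot] exists, as [kappa] and the cofinality of a
     limit are positive. *)
  have [//|[a ba]|lb] := bot_succ_limit beta.
  + by rewrite ba in ce; case: (nochild \bot); apply/(cone_rcons_succ ce).
  + by case: (nochild \bot); apply/(cone_rcons_limit lb ce); exact: cf_limit_gt0.
split; first exact: cone_tree ce.
apply/seteqP; split=> // nu [t [i nuE]]; move: t.
by rewrite nuE -cats1 /= ce b0 => /tree_bot_cons.
Qed.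

Lemma cone_nonleaf {eta beta} : cone eta beta -> nonleaf T eta <-> beta <> \bot.
Proof.
move=> ce; rewrite -(cone_leaf ce); split=> [[]//|nl].
by split=> //; exact: cone_tree ce.
Qed.

Lemma exists_cone {eta} : T eta -> exists beta, cone eta beta.
Proof.
rewrite /cone /T; move: alpha; elim: eta => [|i eta IH] a t; first by exists a.
have [a0|[b ab]|la] := bot_succ_limit a.
- by rewrite a0 in t; case: (tree_bot_cons t).
- rewrite ab in t *; have [ik /IH[beta ce]] := tree_succ_cons.1 t.
  by exists beta => nu; rewrite -ce /= tree_succ_cons; split=> [[]|].
- have [ik /IH[beta ce]] := (tree_limit_cons la).1 t.
  by exists beta => nu; rewrite -ce /= tree_limit_cons //; split=> [[]|].
Qed.

(** By induction on [beta]. At a limit, the ranks of the children are the ladder values plus 4: they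
    stay below [beta] and remain cofinal in it. *)
Lemma cone_has_rank {eta beta} : cone eta beta -> has_rank T eta beta.
Proof.
elim/(well_founded_ind (@ord_lt_wf d O)): beta eta => beta IH eta ce.
have [b0|[a ba]|lb] := bot_succ_limit beta.
- by rewrite b0; apply: rank_leaf; apply/(cone_leaf ce).
- rewrite ba in ce IH *; apply: (@rank_nonleaf _ _ _ _ (fun=> a)).
  + by apply/(cone_nonleaf ce); exact: osucc_neq_bot.
  + move=> nu [t [i nuE]]; rewrite nuE in t *.
    apply: IH; first exact: lt_osucc.
    by apply: (cone_child_succ ce); apply/(cone_rcons_succ ce).
  + split=> [_ [nu _ <-]//|u]; apply.
    exists (rcons eta \bot) => //; split; last by exists \bot.
    exact/(cone_rcons_succ ce).
(* The last entry of a child is its index, from which its rank is read off. *)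
- apply: (@rank_nonleaf _ _ _ _
    (fun nu => iter 4 osucc (c beta (last \bot nu)))).
  + by apply/(cone_nonleaf ce); exact: lb.1.
  + move=> nu [t [i nuE]]; rewrite nuE last_rcons in t *.
    have ik := (cone_rcons_limit lb ce i).1 t.
    apply: IH; last exact: cone_child_limit.
    by apply: iter_osucc_lt_limit => //; exact: (lfunP c lb).1.
  + split=> [_ [nu [t [i nuE]] <-]|u uP].
      rewrite nuE last_rcons in t *; apply/ltW/lb.2/iter_osucc_lt_limit => //.
      exact/(lfunP c lb).1/(cone_rcons_limit lb ce).
    rewrite leNgt; apply/negP => /(lfunP c lb).2[i ik].
    rewrite leNgt => /negP; apply.
    have lt_iter n (b : O) : b < iter n.+1 osucc b.
      elim: n => [|n IHn]; first exact: lt_osucc.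
      by apply: lt_trans IHn _; exact: lt_osucc.
    (* Five successors: the shift by 4 in the tree and the one in the supremum that defines the
       rank. *)
    apply: (lt_le_trans (lt_iter 4%N _)); apply: uP.
    exists (rcons eta i); last by rewrite last_rcons.
    by split; [apply/(cone_rcons_limit lb ce) | exists i].
Qed.

Lemma cone_small_limit {eta beta} : cone eta beta ->
  small_limit_node T kappa eta <-> small_limit kappa beta.
Proof.
move=> ce; split=> [[_ [rho hr sl]]|sl].
  by rewrite (has_rank_uniq (cone_has_rank ce) hr).
by split; [exact: cone_tree ce | exists beta => //; exact: cone_has_rank].
Qed.

Definition wide (eta : node O) : Prop := forall i, i < kappa -> T (rcons eta i).

(** A node of successor rank has [kappa] children and one of limit rank has as many as the
    cofinality, so only small limits fall short of [kappa]. *)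
Lemma nonleaf_wide_or_small {eta} : nonleaf T eta ->
  wide eta \/ small_limit_node T kappa eta.
Proof.
move=> nl; have [beta ce] := exists_cone nl.1.
have [b0|[a ba]|lb] := bot_succ_limit beta.
- by move/(cone_nonleaf ce): nl.
- by left=> i ik; rewrite ba in ce; apply/(cone_rcons_succ ce).
- have [ck|kc] := ltP (cf beta) kappa; first by right; apply/(cone_small_limit ce).
  by left=> i ik; apply/(cone_rcons_limit lb ce); exact: lt_le_trans kc.
Qed.

Lemma small_limit_child {zeta} : small_limit_node T kappa zeta ->
  exists i, succs T zeta (rcons zeta i).
Proof.
move=> sz; have [beta ce] := exists_cone sz.1.
have [lb _] := (cone_small_limit ce).1 sz.
exists \bot; split; last by exists \bot.
by apply/(cone_rcons_limit lb ce); exact: cf_limit_gt0.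
Qed.

(** The shift in the tree gives the children of a small limit node rank [b + 4], hence the
    grandchildren rank [b + 3]. None of them is a leaf or a small limit node, and all are wide. *)
Lemma small_limit_succs {zeta nu} : small_limit_node T kappa zeta ->
  succs T zeta nu -> exists b, cone nu (iter 4 osucc b).
Proof.
move=> sz [t [i nuE]]; rewrite nuE in t *; have [beta ce] := exists_cone sz.1.
have [lb _] := (cone_small_limit ce).1 sz.
by exists (c beta i); apply: cone_child_limit => //; apply/(cone_rcons_limit lb ce).
Qed.

Lemma small_limit_succs2 {zeta nu} : small_limit_node T kappa zeta ->
  succs2 T zeta nu -> exists b, cone nu (iter 3 osucc b).
Proof.
move=> sz [nu' /(small_limit_succs sz)[b cb] [t [i nuE]]]; rewrite nuE in t *.
by exists b; apply: (cone_child_succ cb); apply/(cone_rcons_succ cb).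
Qed.

Lemma cone_succ_not_small {eta b} : cone eta (osucc b) ->
  ~ small_limit_node T kappa eta.
Proof. by move=> ce /(cone_small_limit ce)[/not_limit_osucc]. Qed.

Lemma cone_succ_nonleaf {eta b} : cone eta (osucc b) -> nonleaf T eta.
Proof. by move=> ce; apply/(cone_nonleaf ce); exact: osucc_neq_bot. Qed.

Lemma cone_succ_wide {eta b} : cone eta (osucc b) -> wide eta.
Proof. by move=> ce i ik; apply/(cone_rcons_succ ce). Qed.

End Ranks.

Arguments cone {d O} kappa c alpha eta beta.
Arguments wide {d O} kappa c alpha eta.

(** * Extending a condition so that it decides membership at a node *)

Section Extension.
Context {d : Order.disp_t} {O : ordType d}.
Variables (kappa : O) (c : ladder O) (alpha : O).
Variables (A B X : set (baire kappa)).
Hypothesis kreg : regular_cardinal kappa.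
Hypothesis AB0 : A `&` B = set0.

Let T := tree kappa c alpha.
Let kappa_gt0 : \bot < kappa := limit_gt0 (regular_limit kreg).

(* The second clause in the definition of [critical]; by (c), (d) and (e) it
   also says that [(eta, x)] cannot be added to [Rpart p]. *)
Definition blocked (p : precond kappa) (x : baire kappa) (eta : node O) : Prop :=
  [\/ eta <> [::] /\ Rpart p (npred eta, x),
      [/\ eta <> [::], npred eta = [::] & A x] |
      eta = [::] /\ B x].

Definition add_R (p : precond kappa) (e : node O * baire kappa) : precond kappa :=
  Precond (fpart p) (Rpart p `|` [set e]).

Definition add_f (p : precond kappa) (e : node O * shortseq kappa) : precond kappa :=
  Precond (fpart p `|` [set e]) (Rpart p).

Lemma npred_rcons (eta : node O) i : npred (rcons eta i) = eta.
Proof. by rewrite /npred size_rcons /= -cats1 take_size_cat. Qed.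

Lemma rcons_neq_nil (eta : node O) i : rcons eta i <> [::].
Proof. by case: eta. Qed.

Lemma size_succs {eta nu : node O} : succs T eta nu -> size nu = (size eta).+1.
Proof. by move=> [_ [i ->]]; rewrite size_rcons. Qed.

Lemma succs_npred (eta : node O) : T eta -> eta <> [::] -> succs T (npred eta) eta.
Proof.
case/lastP: eta => // eta i te _; rewrite npred_rcons.
by split=> //; exists i.
Qed.

Lemma size_npred (eta : node O) : (size (npred eta) <= size eta)%N.
Proof. by rewrite /npred size_take_min; apply: leq_trans (geq_minl _ _) (leq_pred _). Qed.

Lemma blocked_rcons p x eta i : blocked p x (rcons eta i) <->
  Rpart p (eta, x) \/ eta = [::] /\ A x.
Proof.
rewrite /blocked npred_rcons; have nn := rcons_neq_nil eta i.
split=> [[[_ ?]|[_ ? ?]|[/nn//]]|[?|[? ?]]].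
- by left.
- by right.
- by constructor 1.
- by constructor 2.
Qed.

Lemma bm_R_nonleaf p eta x : bm_cond c alpha A B X p -> Rpart p (eta, x) ->
  nonleaf T eta /\ X x.
Proof. by move=> pc /(bm_R_dom pc)[]. Qed.

(** A child is blocked by [(eta, x)] in R, which (c), (e) and (d) exclude when [eta] is blocked, or
    by [A x] at the root, where being blocked means [B x]. *)
Lemma not_blocked_pred p x eta i : bm_cond c alpha A B X p ->
  T (rcons eta i) -> nonleaf T eta -> blocked p x eta -> ~ blocked p x (rcons eta i).
Proof.
move=> pc ti nle be /blocked_rcons[Re|[e Ax]]; last first.
  case: be => [[]//|[]//|[_ Bx]].
  by have : (A `&` B) x by []; rewrite AB0.
case: be => [[e0 Rp]|[e0 pe Ax]|[e0 Bx]].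
- have se : succs T (npred eta) eta by apply: succs_npred => //; case: nle.
  by have [/(_ nle)] := bm_c pc se Rp.
- have : ([set y | exists2 nu, succs T [::] nu & Rpart p (nu, y)] `&` A) x.
    split=> //; exists eta => //; rewrite -pe.
    by apply: succs_npred => //; case: nle.
  by rewrite (bm_e pc).
- have : ([set y | Rpart p ([::], y)] `&` B) x by split=> //=; rewrite -e0.
  by rewrite (bm_d pc).
Qed.

(** Not being blocked secures (d), (e) and the half of (c) about the parent; the condition on
    children secures the other half. For (f), the new pair matters in two ways: as the pair at the
    parent of a node, or as the pair at a grandchild. The last two hypotheses treat these. *)
Lemma add_R_cond p eta x : bm_cond c alpha A B X p ->
  nonleaf T eta -> X x -> ~ blocked p x eta ->
  (forall nu, succs T eta nu -> ~ Rpart p (nu, x) /\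
    forall s, fpart p (nu, s) -> ~ basic_open s x) ->
  (forall zeta, succs T eta zeta -> small_limit_node T kappa zeta ->
    (exists2 nu', succs2 T zeta nu' & Rpart p (nu', x)) ->
    exists2 nu, succs T zeta nu &
      forall nu', succs T nu nu' -> ~ Rpart p (nu', x)) ->
  (forall zeta, succs2 T zeta eta -> small_limit_node T kappa zeta ->
    blocked p x zeta ->
    exists2 nu, succs T zeta nu &
      forall nu', succs T nu nu' -> ~ Rpart p (nu', x) /\ nu' <> eta) ->
  bm_cond c alpha A B X (add_R p (eta, x)).
Proof.
move=> pc nle Xx nb hsucc hbelow habove.
split; rewrite /=.
- exact: bm_f_dom pc.
- exact: bm_f_fun pc.
- exact: bm_f_card pc.
- by move=> e [/(bm_R_dom pc)//|->].
- exact: card_ltU1 (bm_R_card pc).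
- move=> zeta nu y szn [Rz|[ze ->]]; last rewrite ze in szn.
    have [h1 h2] := bm_c pc szn Rz; split=> // nln [/h1 []//|[ne ye]].
    apply: nb; move: szn; rewrite ne => -[_ [i ei]].
    by rewrite ei; apply/blocked_rcons; left; rewrite -ye.
  have [h1 h2] := hsucc nu szn; split=> // _ [//|[ne]].
  by have /eqP := size_succs szn; rewrite ne ltn_eqF.
- apply/seteqP; split=> // y [[Ry|[e ye]] By].
    by rewrite -(bm_d pc).
  by apply: nb; constructor 3; rewrite -ye.
- apply/seteqP; split=> // y [[nu sn [Ry|[e ye]]] Ay].
    by rewrite -(bm_e pc); split=> //; exists nu.
  apply: nb; case: sn => _ [i]; rewrite e => ->.
  by apply/blocked_rcons; right; rewrite -ye.
- move=> y zeta [sz bz [eta' s2 Re]].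
  have [[eta2 s2x]|ns] := pselect (succs2 T zeta eta /\ y = x).
    (* The new pair does not itself block [zeta]: [eta] is two entries longer than [zeta], whereas
       [npred zeta] is no longer than [zeta]. *)
    have {}bz : blocked p x zeta.
      case: bz => [[z0 [Rz|[ze _]]]|?|?]; last 2 first.
      + by constructor 2; rewrite -s2x.
      + by constructor 3; rewrite -s2x.
      + by constructor 1; rewrite -s2x.
      + case: eta2 => nu1 /size_succs s1 /size_succs s2'.
        by have := size_npred zeta; rewrite ze s2' s1 ltnNge leqnSn.
    have [nu sn hn] := habove zeta eta2 sz bz.
    exists nu => // nu' /hn[h1 h2]; rewrite s2x => -[//|[]//].
  (* Here the new pair is not an [(eta', y)] with [eta'] a grandchild of [zeta], so a witness of (f)
     for [p] remains one. *)
  suff [nu sn hn] : exists2 nu, succs T zeta nu &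
      forall nu', succs T nu nu' -> ~ Rpart p (nu', y).
    exists nu => // nu' sn' [/hn|[e1 e2]]; first exact.
    by apply: ns; split=> //; exists nu => //; rewrite -e1.
  have {}Re : Rpart p (eta', y).
    by case: Re => // -[e1 e2]; case: ns; rewrite -e1.
  case: bz => [[z0 [Rz|[ze yx]]]|?|?].
  + by apply: (bm_f pc); split=> //; [constructor 1 | exists eta'].
  + rewrite yx in Re *; apply: hbelow => //; last by exists eta'.
    by rewrite -ze; apply: succs_npred => //; case: sz.
  + by apply: (bm_f pc); split=> //; [constructor 2 | exists eta'].
  + by apply: (bm_f pc); split=> //; [constructor 3 | exists eta'].
Qed.

Lemma npred_succs (eta nu : node O) : succs T eta nu -> npred nu = eta.
Proof. by move=> [_ [i ->]]; exact: npred_rcons. Qed.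

Lemma add_f_cond p eta nu s : bm_cond c alpha A B X p ->
  succs T eta nu -> leaf T nu -> (forall s', ~ fpart p (nu, s')) ->
  (forall y, Rpart p (eta, y) -> ~ basic_open s y) ->
  bm_cond c alpha A B X (add_f p (nu, s)).
Proof.
move=> pc sn ln nf sep; split; rewrite /=.
- by move=> zeta s' [/(bm_f_dom pc)//|[-> _]].
- move=> zeta s1 s2 [f1|[e1 ->]] [f2|[e2 ->]] //; first exact: bm_f_fun pc _ _ _ f1 f2.
    by case: (nf s1); rewrite -e2.
  by case: (nf s2); rewrite -e1.
- exact: card_ltU1 (bm_f_card pc).
- exact: bm_R_dom pc.
- exact: bm_R_card pc.
- move=> zeta nu' y szn Rz; have [h1 h2] := bm_c pc szn Rz.
  split=> // ln' s' [|[ne ->]]; first exact: h2.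
  by apply: sep; rewrite -(npred_succs _ _ sn) -ne (npred_succs _ _ szn).
- exact: bm_d pc.
- exact: bm_e pc.
- exact: bm_f pc.
Qed.

(** Fewer than [kappa] sequences differ from [x] first at places bounded by some [b] below [kappa];
    the restriction of [x] to [b] separates them from [x]. *)
Lemma exists_separating {U : Type} (S : set U) (y : U -> baire kappa)
    (x : baire kappa) : card_lt S kappa ->
  exists2 s, basic_open s x & forall t, S t -> y t <> x -> ~ basic_open s (y t).
Proof.
move=> Sk; pose D t := [set i | exists2 j : ord kappa, sval j = i & x j <> y t j].
have [b bk hb] := card_lt_bounded kreg (fun t => oleast (D t)) Sk.
pose xb (j : ord b) := x (exist _ (sval j) (lt_trans (svalP j) bk)).
exists (@ShortSeq d O kappa (exist _ b bk) xb).
  move=> i [j jk] /= ij; rewrite /xb; congr (x _); exact: eq_exist.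
move=> t St /eqP yx /=; have [j xj] : exists j, x j <> y t j.
  by apply: contrapT => nj; case/eqP: yx; apply/funext => j;
    apply: contrapT => xj; apply: nj; exists j => /esym.
have Dj : D t (sval j) by exists j.
have [[[j' j'k] /= j'E xj'] _] := oleastP Dj.
have j'b : j' < b by rewrite j'E; apply: hb => //; rewrite -j'E.
move=> /(_ (exist _ j' j'b) (exist _ j' j'k) erefl) /= e.
by apply: xj'; rewrite -e /xb; congr (x _); exact: eq_exist.
Qed.

(** The first alternative will put [x] into the set at [eta]; each of the others puts [x] into the
    set at a child, and thereby keeps it out of the set at [eta]. *)
Definition witnessed (p : precond kappa) (eta : node O) (x : baire kappa) : Prop :=
  Rpart p (eta, x) \/ exists2 nu, succs T eta nu &
    Rpart p (nu, x) \/ exists2 s, fpart p (nu, s) & basic_open s x.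

Definition ext_witnessed (p : precond kappa) eta x : Prop :=
  exists q, [/\ bm_cond c alpha A B X q, fpart p `<=` fpart q,
    Rpart p `<=` Rpart q & witnessed q eta x].

Lemma ext_add_R p eta zeta x : bm_cond c alpha A B X (add_R p (zeta, x)) ->
  zeta = eta \/ succs T eta zeta -> ext_witnessed p eta x.
Proof.
move=> qc ez; exists (add_R p (zeta, x)); split=> //; first exact: subsetUl.
case: ez => [->|sz]; first by left; right.
by right; exists zeta => //; left; right.
Qed.

(** A child of [eta] with no mention in [p] at or above it in the tree order is put into R, or given
    a sequence if it is a leaf. The last hypothesis protects (f) at the parent of [eta], of which
    this child is a grandchild. *)
Lemma wide_ext_witnessed p eta x : bm_cond c alpha A B X p ->
  nonleaf T eta -> wide kappa c alpha eta -> X x -> ~ Rpart p (eta, x) ->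
  ~ (eta = [::] /\ A x) ->
  (forall zeta, succs T zeta eta -> small_limit_node T kappa zeta ->
    ~ blocked p x zeta) ->
  ext_witnessed p eta x.
Proof.
move=> pc nle we Xx nR nA npre.
(* For a node properly extending [eta], the entry at position [size eta] tells which child of [eta]
   it passes through. An index bounding all these entries is fresh. *)
have [b1 b1k hb1] :=
  card_lt_bounded kreg (fun e => nth \bot e.1 (size eta)) (bm_R_card pc).
have [b2 b2k hb2] :=
  card_lt_bounded kreg (fun e => nth \bot e.1 (size eta)) (bm_f_card pc).
pose i := Order.max b1 b2.
have ik : i < kappa by rewrite gt_max b1k.
have nthi nu : nth \bot (rcons eta i ++ nu) (size eta) = i.
  by rewrite cat_rcons nth_cat ltnn subnn.
have fR nu y : ~ Rpart p (rcons eta i ++ nu, y).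
  by move=> /hb1 /=; rewrite nthi => /(_ ik); rewrite gt_max ltxx.
have ff nu s : ~ fpart p (rcons eta i ++ nu, s).
  by move=> /hb2 /=; rewrite nthi => /(_ ik); rewrite gt_max ltxx andbF.
have sei : succs T eta (rcons eta i) by split; [exact: we | exists i].
have [lf|nlf] := pselect (leaf T (rcons eta i)).
  (* By (c), the sequence at a leaf must avoid every [y] with [(eta, y)] in R; [x] is not among them
     by [nR]. *)
  have [s sx sep] := exists_separating _ (fun e => e.2) x (bm_R_card pc).
  exists (add_f p (rcons eta i, s)); split=> //; last first.
  - by right; exists (rcons eta i) => //; right; exists s => //; right.
  - exact: subsetUl.
  apply: add_f_cond pc sei lf _ _ => [s'|y Ry].
    by have := ff [::] s'; rewrite cats0.
  by apply: (sep (eta, y)) => //= yx; apply: nR; rewrite -yx.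
apply: (ext_add_R _ _ (rcons eta i)); last by right.
apply: add_R_cond => //.
- by split=> //; exact: sei.1.
- by move=> /blocked_rcons[/nR|/nA].
- by move=> nu [_ [j ->]]; rewrite -cats1; split=> // s /ff.
- move=> zeta [_ [j ->]] _ [nu' [_ [_ [k ->]] [_ [l ->]]]].
  by rewrite -[rcons _ l]cats1 -[rcons _ k]cats1 -[rcons _ j]cats1 -!catA => /fR.
- move=> zeta [eta' sz /npred_succs]; rewrite npred_rcons => e; rewrite -e in sz.
  by move=> sl bz; case: (npre _ sz sl).
Qed.

(* The shift by 4 in [tree] keeps the nodes at most two levels below a small
   limit node from being small limit nodes themselves, so that the instances
   of (f) do not interfere. *)
Lemma ext_witnessedP p eta x : bm_cond c alpha A B X p ->
  nonleaf T eta -> X x -> ext_witnessed p eta x.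
Proof.
move=> pc nle Xx; apply: contrapT => nw.
have nwp : ~ witnessed p eta x by move=> wp; apply: nw; exists p; split.
have nR : ~ Rpart p (eta, x) by move=> ?; apply: nwp; left.
have nchild nu : succs T eta nu -> ~ Rpart p (nu, x) /\
    forall s, fpart p (nu, s) -> ~ basic_open s x.
  move=> sn; split=> [Rn|s fs sx]; apply: nwp; right; exists nu => //.
    by left.
  by right; exists s.
have small_child zeta nu : small_limit_node T kappa zeta -> succs T zeta nu ->
    nonleaf T nu /\ ~ small_limit_node T kappa nu.
  move=> sz /(small_limit_succs kappa_gt0 sz)[b cb].
  by split; [exact: cone_succ_nonleaf cb | exact: cone_succ_not_small cb].
have fleaf nu s : fpart p (nu, s) -> ~ nonleaf T nu.
  by move=> /(bm_f_dom pc) ? [].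
have [be|nbe] := pselect (blocked p x eta).
  have nA : ~ (eta = [::] /\ A x).
    move=> [e Ax]; case: be => [[]//|[]//|[_ Bx]].
    by have : (A `&` B) x by []; rewrite AB0.
  (* A blocked node has only unblocked children, so the parent of a blocked node is not blocked. *)
  have npre zeta : succs T zeta eta -> ~ blocked p x zeta.
    move=> [te [i ei]] bz; rewrite ei in te be.
    have nlz : nonleaf T zeta.
      split=> [|[_ z0]]; first exact: tree_rcons te.
      have : succs T zeta (rcons zeta i) by split=> //; exists i.
      by rewrite z0.
    exact: (not_blocked_pred _ _ _ _ pc te nlz bz be).
  have [we|se] := nonleaf_wide_or_small kappa_gt0 nle.
    by apply: nw; apply: wide_ext_witnessed => // zeta /npre.
  (* If [eta] is critical, (f) provides the child; if not, no grandchild is in R with [x] and any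
     child serves. *)
  have [nu sn hn] : exists2 nu, succs T eta nu &
      forall nu', succs T nu nu' -> ~ Rpart p (nu', x).
    have [cr|ncr] := pselect (exists2 eta', succs2 T eta eta' & Rpart p (eta', x)).
      by apply: (bm_f pc).
    have [i si] := small_limit_child kappa_gt0 se.
    exists (rcons eta i) => // nu' sn' Rn; apply: ncr.
    by exists nu' => //; exists (rcons eta i).
  apply: nw; apply: (ext_add_R _ _ nu); last by right.
  have [nln nsn] := small_child _ _ se sn.
  apply: add_R_cond => //.
  - by case: sn => _ [i ->] /blocked_rcons[/nR|/nA].
  - move=> nu' sn'; split; first exact: hn.
    move=> s /fleaf[]; have [b cb] : exists b, cone kappa c alpha nu' (iter 3 osucc b).
      by apply: (small_limit_succs2 kappa_gt0 se); exists nu.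
    exact: cone_succ_nonleaf cb.
  - move=> zeta sz; have [b cb] : exists b, cone kappa c alpha zeta (iter 3 osucc b).
      by apply: (small_limit_succs2 kappa_gt0 se); exists nu.
    by move=> /(cone_succ_not_small kappa_gt0 cb).
  - move=> zeta [eta' sz /npred_succs e] _ bz; case: (npre zeta) => //.
    by rewrite -e (npred_succs _ _ sn) in sz *.
(* Otherwise [eta] has rank [b + 3], and a fresh child of [eta] can be added. *)
have habove zeta : succs2 T zeta eta -> small_limit_node T kappa zeta ->
    exists2 nu, succs T zeta nu &
      forall nu', succs T nu nu' -> ~ Rpart p (nu', x) /\ nu' <> eta.
  move=> s2 sz; exfalso; apply: nw.
  have [b cb] := small_limit_succs2 kappa_gt0 sz s2.
  case: s2 => nu sn se; apply: wide_ext_witnessed => //.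
  - exact: cone_succ_wide cb.
  - by case: se => _ [i ->] [/rcons_neq_nil].
  - move=> xi /npred_succs; rewrite (npred_succs _ _ se) => <- snu.
    by have [] := small_child _ _ sz sn.
(* Otherwise nothing prevents adding [(eta, x)]. *)
have [zeta [sez sz nwit]] : exists zeta, [/\ succs T eta zeta,
    small_limit_node T kappa zeta &
    forall nu, succs T zeta nu -> exists2 nu', succs T nu nu' & Rpart p (nu', x)].
  apply: contrapT => nz; apply: nw; apply: (ext_add_R _ eta eta); last by left.
  apply: add_R_cond => //; last by move=> zeta ? ? _; exact: habove.
  move=> zeta sez sz _; apply: contrapT => nwit; apply: nz.
  exists zeta; split=> // nu sn; apply: contrapT => nn; apply: nwit.
  by exists nu => // nu' sn' Rn; apply: nn; exists nu'.
apply: nw; apply: (ext_add_R _ _ zeta); last by right.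
have nlz : nonleaf T zeta.
  split=> [|[_ z0]]; first by case: sz.
  by have [i] := small_limit_child kappa_gt0 sz; rewrite z0.
apply: add_R_cond => //.
(* Were [zeta] blocked, it would be critical in [p], and (f) would contradict [nwit]. *)
- move=> bz; have cz : critical c alpha A B p x zeta.
    split=> //; have [i si] := small_limit_child kappa_gt0 sz.
    by have [nu' ? ?] := nwit _ si; exists nu' => //; exists (rcons zeta i).
  have [nu sn hn] := bm_f pc cz.
  by have [nu' /hn] := nwit nu sn.
(* A child of [nu] is in R with [x], so by (c) [nu] is not. *)
- move=> nu sn; have [nu' sn' Rn'] := nwit nu sn; split.
    by move=> /(bm_c pc sn')[nRn' _]; exact: nRn' (bm_R_nonleaf _ _ _ pc Rn').1 Rn'.
  by move=> s /fleaf[]; have [] := small_child _ _ sz sn.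
- by move=> nu sn snu; have [] := small_child _ _ sz sn.
- move=> xi s2 sxi _; have [b cb] := small_limit_succs2 kappa_gt0 sxi s2.
  by case: (cone_succ_not_small kappa_gt0 cb sz).
Qed.

End Extension.

(** * The forcing relation on derived connectives *)

Section Forcing.
Context {P : Type} {le : P -> P -> Prop}.
Hypothesis le_refl : forall p, le p p.

Lemma forces_And p (phi psi : formula P) :
  forces le p (And phi psi) <-> forces le p phi /\ forces le p psi.
Proof.
split=> [h|[hphi hpsi] [|]//].
by split; [exact: (h true) | exact: (h false)].
Qed.

Lemma forces_Imp p (phi psi : formula P) :
  (forall q, le q p -> forces le q phi -> ~ forces le q (Neg psi)) ->
  forces le p (Imp phi psi).
Proof. by move=> h q qp /forces_And[fphi]; exact: h. Qed.

(** As [Ex] is a negated conjunction of negations, a forced existential yields its witness only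
    below some extension. *)
Lemma forces_Ex_le p (I : Type) (F : I -> formula P) : forces le p (Ex F) ->
  exists i q, le q p /\ forces le q (F i).
Proof.
move=> /(_ p (le_refl p)) h; apply: contrapT => nF; apply: h => i q qp fq.
by apply: nF; exists i, q.
Qed.

Lemma forces_Ex p (I : Type) (F : I -> formula P) i :
  (forall q, le q p -> forces le q (F i)) -> forces le p (Ex F).
Proof. by move=> fi q qp /(_ i q (le_refl q)); apply; exact: fi. Qed.

End Forcing.

(** * Deciding the generic sets by conditions *)

Section Genericity.
Context {d : Order.disp_t} {O : ordType d}.
Variables (kappa : O) (c : ladder O) (alpha : O).
Variables (A B X : set (baire kappa)).
Hypothesis kreg : regular_cardinal kappa.
Hypothesis AB0 : A `&` B = set0.

Let T := tree kappa c alpha.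
Let BMT := BM c alpha A B X.
Let Gset := in_Gset c alpha A B X.

Lemma BM_le_refl (p : BMT) : BM_le p p.
Proof. by split. Qed.

Lemma BM_le_trans (p q r : BMT) : BM_le p q -> BM_le q r -> BM_le p r.
Proof.
move=> [f1 R1] [f2 R2]; split.
- exact: subset_trans f2 f1.
- exact: subset_trans R2 R1.
Qed.

Lemma forces_in_RG (p : BMT) eta x : Rpart (sval p) (eta, x) ->
  forces BM_le p (in_RG c alpha A B X eta x).
Proof.
move=> Rp; apply: (forces_Ex BM_le_refl _ _ _ p) => q qp.
apply/forces_And; split=> // r rq; exists r; first exact: BM_le_refl.
exact: BM_le_trans rq qp.
Qed.

Lemma forces_in_RG_le (p : BMT) eta x : forces BM_le p (in_RG c alpha A B X eta x) ->
  exists2 q, BM_le q p & Rpart (sval q) (eta, x).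
Proof.
move=> /(forces_Ex_le BM_le_refl)[t [q [qp /forces_And[Gq Rt]]]].
(* Forcing [t] into the generic filter gives a common extension of [q] and [t], which inherits the
   pair from [t]. *)
have [r rq [_ rt]] := Gq q (BM_le_refl q).
by exists r; [exact: BM_le_trans rq qp | exact: rt].
Qed.

Lemma forces_in_fG (p : BMT) eta s : fpart (sval p) (eta, s) ->
  forces BM_le p (in_fG c alpha A B X eta s).
Proof.
move=> fp; apply: (forces_Ex BM_le_refl _ _ _ p) => q qp.
apply/forces_And; split=> // r rq; exists r; first exact: BM_le_refl.
exact: BM_le_trans rq qp.
Qed.

Lemma forces_in_fG_le (p : BMT) eta s : forces BM_le p (in_fG c alpha A B X eta s) ->
  exists2 q, BM_le q p & fpart (sval q) (eta, s).
Proof.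
move=> /(forces_Ex_le BM_le_refl)[t [q [qp /forces_And[Gq ft]]]].
have [r rq [rt _]] := Gq q (BM_le_refl q).
by exists r; [exact: BM_le_trans rq qp | exact: rt].
Qed.

Lemma forces_Gset_leaf (p : BMT) eta s x : leaf T eta -> X x ->
  fpart (sval p) (eta, s) -> basic_open s x -> forces BM_le p (Gset eta x).
Proof.
move=> ln Xx fp sx; rewrite /Gset in_GsetE /in_Gset_step; case: pselect => //= _.
apply/forces_And; split=> //; apply: (forces_Ex BM_le_refl _ _ _ s) => q [qp _].
by apply/forces_And; split=> //; apply: forces_in_fG; exact: qp.
Qed.

Lemma forces_Gset_leaf_le (p : BMT) eta x : leaf T eta ->
  forces BM_le p (Gset eta x) ->
  exists q s, [/\ BM_le q p, fpart (sval q) (eta, s) & basic_open s x].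
Proof.
move=> ln; rewrite /Gset in_GsetE /in_Gset_step; case: pselect => //= _.
move=> /forces_And[/(forces_Ex_le BM_le_refl)[s [q [qp /forces_And[fq sx]]]] _].
have [r rq fr] := forces_in_fG_le _ _ _ fq.
by exists r, s; split=> //; exact: BM_le_trans rq qp.
Qed.

Lemma forces_Gset_nonleaf (p : BMT) eta x : nonleaf T eta -> X x ->
  forces BM_le p (Gset eta x) <->
  forall nu, succs T eta nu -> forall q, BM_le q p -> ~ forces BM_le q (Gset nu x).
Proof.
move=> [_ nle] Xx; rewrite /Gset in_GsetE /in_Gset_step; case: pselect => //= _.
split=> [h nu sn q qp|h [nu sn]].
  by have /forces_And[_] := h (exist _ nu sn); apply.
by apply/forces_And; split=> // q qp; exact: h.
Qed.

Lemma ext_witnessed_BM (p : BMT) eta x : nonleaf T eta -> X x ->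
  exists2 q : BMT, BM_le q p & witnessed kappa c alpha (sval q) eta x.
Proof.
move=> nle Xx; have [q [qc fq Rq wq]] :=
  ext_witnessedP _ _ _ _ _ _ kreg AB0 _ _ _ (svalP p) nle Xx.
by exists (exist _ q qc).
Qed.

(** Both halves go by one induction from children to parents, each using the other half at the
    children. For the first, an extension containing a child's witness together with [(eta, x)]
    would violate (c). *)
Lemma forces_Gset_iff eta : nonleaf T eta ->
  (forall (p : BMT) x, Rpart (sval p) (eta, x) -> forces BM_le p (Gset eta x)) /\
  (forall (p : BMT) x, X x -> forces BM_le p (Gset eta x) ->
     exists2 q, BM_le q p & Rpart (sval q) (eta, x)).
Proof.
elim/(well_founded_ind (@tree_wf d O kappa c alpha)): eta => eta IH nle.
have leafP nu : succs T eta nu -> ~ nonleaf T nu -> leaf T nu.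
  by move=> [tn _] nl; apply: contrapT => ?; apply: nl.
split=> [p x Rp|p x Xx].
  have Xx : X x by have [] := bm_R_dom (svalP p) Rp.
  apply/forces_Gset_nonleaf => // nu sn q [fqp Rqp] fq.
  have [nln|/(leafP _ sn) ln] := pselect (nonleaf T nu).
    have [r [_ Rrq] Rr] := (IH nu sn nln).2 q x Xx fq.
    by have [/(_ nln)] := bm_c (svalP r) sn (Rrq _ (Rqp _ Rp)).
  have [r [s [[_ Rrq] fr sx]]] := forces_Gset_leaf_le _ _ _ ln fq.
  by have [_ /(_ ln _ fr)] := bm_c (svalP r) sn (Rrq _ (Rqp _ Rp)).
move=> /(forces_Gset_nonleaf _ _ _ nle Xx) fp.
(* Some extension is witnessed at [eta]; a witness at a child would force [x] into the child's set,
   against [fp]. *)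
have [q qp [Rq|[nu sn [Rn|[s fs sx]]]]] := ext_witnessed_BM p _ _ nle Xx.
- by exists q.
- have [nln _] := bm_R_dom (svalP q) Rn.
  by case: (fp nu sn q qp); exact: (IH nu sn nln).1.
- case: (fp nu sn q qp).
  exact: (forces_Gset_leaf _ _ _ _ (bm_f_dom (svalP q) fs) Xx fs sx).
Qed.

End Genericity.

Theorem theorem5p11 (d : Order.disp_t) (O : ordType d) (kappa kappa_plus : O)
    (c : ladder O) (X A B : set (baire kappa)) (alpha : O)
    (hreg : regular_cardinal kappa)
    (hunc : ~ countable (seg kappa))
    (hpow : [set: shortseq kappa] #= seg kappa)
    (hplus : is_succ_cardinal kappa kappa_plus)
    (hA : A `<=` X) (hB : B `<=` X) (hAB : A `&` B = set0)
    (halpha1 : osucc \bot < alpha) (halpha2 : alpha < kappa_plus)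
    (eta : node O) (heta : nonleaf (tree kappa c alpha) eta)
    (x : baire kappa) (hx : X x) :
  forced BM_le
    (Iff (in_Gset c alpha A B X eta x) (in_RG c alpha A B X eta x)).
Proof.
have [Rf fR] := forces_Gset_iff _ _ _ A B X hreg hAB eta heta.
(* An implication is refuted only by a [q] forcing the premise and the negated conclusion, but some
   extension of [q] forces the conclusion. *)
move=> p; apply/forces_And; split; apply: (forces_Imp) => q _ fq fN.
  have [r rq /forces_in_RG] := fR q x hx fq; exact: fN.
have [r rq /Rf] := forces_in_RG_le _ _ _ _ _ _ _ _ _ fq; exact: fN.
Qed.
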